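(* Consider the closed-loop system consisting of the state equation $\dot x(t)=f(x(t),u(t))$, $x(0)=x_0$, the output equation $y(t)=h(x(t))$, and the controller equation $$\dot u(t)=\Big(\frac{\partial g}{\partial u}(x(t),u(t))\Big)^{-1}\Big(r(t+T)-\hat y(t+T)+\dot r(t+T)-\frac{\partial g}{\partial x}(x(t),u(t))\,f(x(t),u(t))\Big),$$ where $\hat y(t+T)=g(x(t),u(t))$. Suppose that the closed-loop trajectory is nonsingular. Define the prediction error $\mathcal E_1(t):=\hat y(t+T)-y(t+T)$ and the asymptotic prediction error $\eta_1:=\limsup_{t\to\infty}\|\mathcal E_1(t)\|$. Then the asymptotic tracking error equals the asymptotic prediction error: $$\limsup_{t\to\infty}\|r(t)-y(t)\|=\eta_1.$$
   Context: Setting: $x(t)\in\mathbb R^n$ is the state, $u(t)\in\mathbb R^m$ the control input, $y(t)\in\mathbb R^m$ the output, $r(t)\in\mathbb R^m$ the reference signal, and $T>0$ a fixed lookahead time. Standing assumptions. (1) $f:\mathbb R^n\times\mathbb R^m\to\mathbb R^n$ is continuously differentiable, and for every compact set $\Gamma\subset\mathbb R^m$ there is $K>0$ such that $\|f(x,u)\|\le K(\|x\|+1)$ for all $x\in\mathbb R^n$, $u\in\Gamma$; $h:\mathbb R^n\to\mathbb R^m$ is continuously differentiable. (2) $g:\mathbb R^n\times\mathbb R^m\to\mathbb R^m$ (the output predictor) is continuously differentiable in $(x,u)$. (3) $r(\cdot)$ is continuous and piecewise differentiable; equations containing $\dot r(t+T)$ are understood at those $t$ where this derivative exists. Notation. The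 predicted output is $\hat y(t+T):=g(x(t),u(t))$ for $t\ge0$, i.e. $\hat y(t)=g(x(t-T),u(t-T))$ for $t\ge T$. $\|\cdot\|$ is the Euclidean norm. A closed-loop trajectory (defined for all $t\ge 0$) is called nonsingular if the partial Jacobian $\frac{\partial g}{\partial u}(x(t),u(t))$ is nonsingular for every $t\ge0$. *)

(* Defs.v *)
From HB Require Import structures.
From mathcomp Require Import all_boot all_order all_algebra.
From mathcomp Require Import all_classical all_reals all_analysis.

Set Implicit Arguments.
Unset Strict Implicit.
Unset Printing Implicit Defensive.

Import Order.TTheory GRing.Theory Num.Theory.
Import numFieldNormedType.Exports.

Local Open Scope classical_set_scope.
Local Open Scope ring_scope.

(* Vectors are row vectors, as required by the library's Jacobian, which      *)
(* satisfies 'd F p v = v *m 'J F p; it is the transpose of the usual column  *)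
(* Jacobian, so A v and A^-1 v become v *m 'J and v *m invmx 'J.              *)

(* The canonical norm on 'rV[R]_n is the sup norm; it is used below only for  *)
(* the topology.                                                              *)
Definition enorm (R : realType) (n : nat) (v : 'rV[R]_n) : R :=
  Num.sqrt (\sum_(i < n) v ord0 i ^+ 2).

(* For finite-dimensional V, pointwise continuity of p |-> 'd F p is the same *)
(* as continuity for the operator norm.                                       *)
Definition continuously_differentiable (R : realType) (V W : normedModType R)
    (F : V -> W) : Prop :=
  (forall p, differentiable F p) /\
  (forall v, continuous (fun p => 'd F p v)).

Definition linear_growth (R : realType) (n m : nat)
    (f : 'rV[R]_n * 'rV[R]_m -> 'rV[R]_n) : Prop :=
  forall Gamma : set 'rV[R]_m, compact Gamma ->
    exists2 K : R, 0 < K &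
      forall x u, Gamma u -> enorm (f (x, u)) <= K * (enorm x + 1).

(* The exceptional set D has finitely many points in each bounded interval.   *)
Definition piecewise_differentiable (R : realType) (V : normedModType R)
    (r : R -> V) : Prop :=
  exists D : set R,
    (forall M : R, finite_set (D `&` `[0, M])) /\
    (forall t : R, 0 < t -> ~ D t -> derivable r t 1).

(* Derivative of a function on [0, +oo[: two-sided at t > 0, one-sided at 0;  *)
(* values at negative times are junk.                                         *)
Definition has_derivative (R : realType) (V : normedModType R)
    (z : R -> V) (t : R) (v : V) : Prop :=
  (s - t)^-1 *: (z s - z t) @[s --> within [set s | 0 <= s] t^'] --> v.

Definition partial_x (R : realType) (n m p : nat)
    (g : 'rV[R]_n * 'rV[R]_m -> 'rV[R]_p) (x : 'rV[R]_n) (u : 'rV[R]_m)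
    : 'M[R]_(n, p) :=
  'J (fun z => g (z, u)) x.

Definition partial_u (R : realType) (n m p : nat)
    (g : 'rV[R]_n * 'rV[R]_m -> 'rV[R]_p) (x : 'rV[R]_n) (u : 'rV[R]_m)
    : 'M[R]_(m, p) :=
  'J (fun w => g (x, w)) u.

(* Where r is not differentiable the controller equation says nothing, so     *)
(* continuity of the input is part of being a trajectory.                     *)
Record closed_loop (R : realType) (n m : nat) (T : R)
    (f : 'rV[R]_n * 'rV[R]_m -> 'rV[R]_n) (h : 'rV[R]_n -> 'rV[R]_m)
    (g : 'rV[R]_n * 'rV[R]_m -> 'rV[R]_m) (r : R -> 'rV[R]_m)
    (x0 : 'rV[R]_n) (x : R -> 'rV[R]_n) (u y yhat : R -> 'rV[R]_m) : Prop :=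
  ClosedLoop {
    initial_state : x 0 = x0;
    input_continuous : {within `[0, +oo[, continuous u};
    state_equation : forall t : R, 0 <= t ->
      has_derivative x t (f (x t, u t));
    output_equation : forall t : R, 0 <= t -> y t = h (x t);
    predictor_equation : forall t : R, 0 <= t -> yhat (t + T) = g (x t, u t);
    controller_equation : forall t : R, 0 <= t -> derivable r (t + T) 1 ->
      has_derivative u t
        ((r (t + T) - yhat (t + T) + derive1 r (t + T)
            - f (x t, u t) *m partial_x g (x t) (u t))
         *m invmx (partial_u g (x t) (u t)))
  }.

Definition nonsingular_trajectory (R : realType) (n m : nat)
    (g : 'rV[R]_n * 'rV[R]_m -> 'rV[R]_m)
    (x : R -> 'rV[R]_n) (u : R -> 'rV[R]_m) : Prop :=
  forall t : R, 0 <= t -> partial_u g (x t) (u t) \in unitmx.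

Definition limsup_enorm (R : realType) (m : nat) (e : R -> 'rV[R]_m) : \bar R :=
  limf_esup (fun t => (enorm (e t))%:E) (pinfty_nbhs R).

Definition prediction_error (R : realType) (m : nat) (T : R)
    (yhat y : R -> 'rV[R]_m) (t : R) : 'rV[R]_m :=
  yhat (t + T) - y (t + T).

(* Main.v *)
(* Along the closed loop the controller is chosen so that                      *)
(* e t := r (t + T) - g (x t, u t) satisfies e' = - e wherever r is            *)
(* differentiable at t + T.  Since e is continuous and the exceptional times   *)
(* are locally finite, expR t *: e t is constant, so e decays exponentially.   *)
(* As r (t + T) - y (t + T) = e t + prediction_error t, the tracking and       *)
(* prediction errors have the same limsup.  Everything is done for t >= 1, so  *)
(* the one-sided derivatives at time 0 never matter.                           *)
Require Import Defs.
From HB Require Import structures.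
From mathcomp Require Import all_boot all_order all_algebra.
From mathcomp Require Import all_classical all_reals all_analysis.
From mathcomp Require Import ring.

Set Implicit Arguments.
Unset Strict Implicit.
Unset Printing Implicit Defensive.

Import Order.TTheory GRing.Theory Num.Theory.
Import numFieldNormedType.Exports.
Local Open Scope classical_set_scope.
Local Open Scope ring_scope.

(** The control law inverts the predictor dynamics: by the chain rule ([is_derive_partial]) and
    nonsingularity, g (x t, u t) has derivative r (t + T) - g (x t, u t) + r' (t + T) wherever r' (t
    + T) exists. Hence the mismatch e between reference and predicted output solves e' = - e off a
    locally finite set, and [exp_decay] gives its norm as a constant times expR (1 - t) from time 1
    on. The tracking error at t + T is the prediction error at t plus e t, so [ler_enormD] bounds
    each of the two by the other plus a vanishing term, and [le_limf_esup_shift] turns each bound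
    into an inequality of limsups. *)

Lemma enorm_ge0 (R : realType) (n : nat) (v : 'rV[R]_n) : 0 <= enorm v.
Proof. exact: sqrtr_ge0. Qed.

Lemma sqr_enorm (R : realType) (n : nat) (v : 'rV[R]_n) :
  enorm v ^+ 2 = \sum_(i < n) v ord0 i ^+ 2.
Proof. by rewrite sqr_sqrtr// sumr_ge0// => i _; exact: sqr_ge0. Qed.

Lemma enormZ (R : realType) (n : nat) (a : R) (v : 'rV[R]_n) :
  enorm (a *: v) = `|a| * enorm v.
Proof.
rewrite /enorm -sqrtr_sqr -sqrtrM ?sqr_ge0// mulr_sumr.
by congr Num.sqrt; apply: eq_bigr => i _; rewrite mxE exprMn.
Qed.

Lemma enormN (R : realType) (n : nat) (v : 'rV[R]_n) : enorm (- v) = enorm v.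
Proof. by rewrite -scaleN1r enormZ normrN1 mul1r. Qed.

Lemma enorm_eq0 (R : realType) (n : nat) (v : 'rV[R]_n) :
  enorm v = 0 -> v = 0.
Proof.
move=> v0; have := sqr_enorm v; rewrite v0 expr0n/= => /esym/eqP.
rewrite psumr_eq0 => [/allP sv0|i _]; last exact: sqr_ge0.
apply/rowP => i; rewrite mxE; apply/eqP.
by rewrite -sqrf_eq0; have := sv0 i (mem_index_enum i).
Qed.

(** Cauchy-Schwarz: with p and q the two norms and c the inner product, expanding the sum of the
    squares (q v_i - p w_i)^2 gives 2 p q (p q - c). Dividing by p q requires both norms to be
    nonzero, hence the two degenerate cases. *)
Lemma sum_mulr_le_enorm (R : realType) (n : nat) (v w : 'rV[R]_n) :
  \sum_(i < n) v ord0 i * w ord0 i <= enorm v * enorm w.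
Proof.
have [/enorm_eq0 ->|p0] := eqVneq (enorm v) 0.
  rewrite big1 => [|i _]; last by rewrite mxE mul0r.
  by rewrite mulr_ge0 ?enorm_ge0.
have [/enorm_eq0 ->|q0] := eqVneq (enorm w) 0.
  rewrite big1 => [|i _]; last by rewrite mxE mulr0.
  by rewrite mulr_ge0 ?enorm_ge0.
have p_gt0 : 0 < enorm v by rewrite lt_def p0 enorm_ge0.
have q_gt0 : 0 < enorm w by rewrite lt_def q0 enorm_ge0.
have : 0 <= \sum_(i < n) (enorm w * v ord0 i - enorm v * w ord0 i) ^+ 2.
  by apply: sumr_ge0 => i _; exact: sqr_ge0.
set p := enorm v in p_gt0 *; set q := enorm w in q_gt0 *.
set c := \sum_(i < n) v ord0 i * w ord0 i.
rewrite (_ : \sum_(i < n) _ = (q * p * (p * q - c)) *+ 2); last first.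
  transitivity (q ^+ 2 * (\sum_(i < n) v ord0 i ^+ 2) - (q * p *+ 2) * c
                + p ^+ 2 * (\sum_(i < n) w ord0 i ^+ 2)).
    rewrite !mulr_sumr -sumrB -big_split/=.
    by apply: eq_bigr => i _; ring.
  by rewrite -!sqr_enorm -/p -/q; ring.
by rewrite pmulrn_lge0// pmulr_rge0 ?mulr_gt0// subr_ge0.
Qed.

Lemma ler_enormD (R : realType) (n : nat) (v w : 'rV[R]_n) :
  enorm (v + w) <= enorm v + enorm w.
Proof.
rewrite -(@ler_pXn2r _ 2) ?nnegrE ?addr_ge0 ?enorm_ge0//.
rewrite sqrrD !sqr_enorm.
under eq_bigr do rewrite mxE sqrrD.
rewrite !big_split/= lerD2r lerD2l mulr2n.
by rewrite lerD ?sum_mulr_le_enorm.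
Qed.

(** A limsup at infinity ignores both a time shift and a vanishing term. The shift T may have either
    sign; both are needed. *)
Lemma le_limf_esup_shift (R : realType) (T : R) (a b c : R -> R) :
  (\forall t \near +oo, b t <= a (t + T) + c t) -> c t @[t --> +oo] --> 0 ->
  (limf_esup (EFin \o b) (pinfty_nbhs R) <=
   limf_esup (EFin \o a) (pinfty_nbhs R))%E.
Proof.
move=> ba c0; apply: le_ereal_inf_tmp => _ [A Aoo <-].
apply/lee_addgt0Pr => e e0.
(* The limsup is an infimum of suprema over neighbourhoods of infinity: B is one on which b is at
   most e above the supremum of a over A. *)
pose B := [set t | A (t + T) /\ b t <= a (t + T) + e].
have Boo : pinfty_nbhs R B.
  have AT : \forall t \near +oo, A (t + T).
    have [M [Mr AM]] := Aoo; exists (M - T); split; first exact: num_real.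
    by move=> t; rewrite ltrBlDr => /AM.
  have /cvgrPdist_le/(_ e e0) ce := c0.
  near=> t; split; first by near: t.
  apply: (@le_trans _ _ (a (t + T) + c t)); first by near: t.
  rewrite lerD2l; apply: le_trans (ler_norm _) _.
  by rewrite -normrN -sub0r; near: t.
apply: le_trans.
  apply: ereal_inf_lbound; exists B; [exact: Boo|reflexivity].
apply: ge_ereal_sup => _ [t [AtT bt] <-].
apply: (@le_trans _ _ ((a (t + T))%:E + e%:E)%E); first by rewrite -EFinD lee_fin.
rewrite leeD2r//; apply: ereal_sup_ubound; exists (t + T) => //.
Unshelve. all: by end_near. Qed.

(** At an interior time the restriction to s >= 0 is vacuous near t; substituting s = h + t then
    gives the library's difference quotient. *)
Lemma has_derivative_is_derive (R : realType) (V : normedModType R)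
    (z : R -> V) (t : R) (v : V) :
  0 < t -> has_derivative z t v -> is_derive t 1 z v.
Proof.
move=> t0 zv.
have zv' : (s - t)^-1 *: (z s - z t) @[s --> t^'] --> v.
  move=> A /zv /=; rewrite !near_simpl /within /= => At.
  near=> s; suff : 0 <= s by near: s.
  by near: s; apply: nbhs_dnbhs; near=> s; apply/ltW; near: s; exact: lt_nbhsr.
have dz : h^-1 *: ((z \o shift t) (h *: 1) - z t) @[h --> 0^'] --> v.
  move=> A /zv' /nbhs_ballP[e e0 eA]; apply/nbhs_ballP; exists e => //= h.
  rewrite -ball_normE/= sub0r normrN => he h0; rewrite [h%:A]mulr1.
  have := eA (h + t); rewrite -ball_normE/= addrK; apply.
    by rewrite opprD addrCA subrr addr0 normrN.
  by rewrite -subr_eq0 addrK.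
by split; [exact: (cvgP _ dz)|exact/cvg_lim].
Unshelve. all: by end_near. Qed.

(* Splitting the interval at an exceptional point shortens [s]; continuity     *)
(* glues the two pieces.                                                       *)
Lemma derive0_finite_exception (R : realType) (w : R -> R) (s : seq R) (a b : R) :
  a <= b -> {in `[a, b], continuous w} ->
  (forall t, t \in `]a, b[ -> t \notin s -> is_derive t 1 w 0) -> w a = w b.
Proof.
elim: s a b => [|c s IH] a b.
  rewrite le_eqVlt => /predU1P[->//|ab] cw dw.
  have [|c _] := @MVT R w (fun=> 0) a b ab (fun t tab => dw t tab isT).
    by apply: continuous_in_subspaceT => t /set_mem; exact: cw.
  by rewrite mul0r => /subr0_eq.
move=> ab cw dw.
have [cab|cNab] := boolP (c \in `]a, b[); last first.
  have dw' t : t \in `]a, b[ -> t \notin s -> is_derive t 1 w 0.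
    move=> tab ts; apply: dw => //.
    by rewrite inE negb_or ts andbT; apply: contraNneq cNab => <-.
  exact: IH ab cw dw'.
have [ac cb] : a < c /\ c < b by move: cab; rewrite in_itv/= => /andP.
have cwl : {in `[a, c], continuous w}.
  move=> t; rewrite in_itv/= => /andP[at_ tc].
  by apply: cw; rewrite in_itv/= at_ (le_trans tc)// ltW.
have cwr : {in `[c, b], continuous w}.
  move=> t; rewrite in_itv/= => /andP[ct tb].
  by apply: cw; rewrite in_itv/= tb (le_trans _ ct)// ltW.
have dwl t : t \in `]a, c[ -> t \notin s -> is_derive t 1 w 0.
  rewrite in_itv/= => /andP[at_ tc] ts; apply: dw.
    by rewrite in_itv/= at_ (lt_trans tc).
  by rewrite inE negb_or ts lt_eqF.
have dwr t : t \in `]c, b[ -> t \notin s -> is_derive t 1 w 0.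
  rewrite in_itv/= => /andP[ct tb] ts; apply: dw.
    by rewrite in_itv/= tb (lt_trans ac).
  by rewrite inE negb_or ts gt_eqF.
by rewrite (IH a c (ltW ac) cwl dwl) (IH c b (ltW cb) cwr dwr).
Qed.

(** Joint differentiability of g allows the split of its differential at (dx, du) into its values at
    (dx, 0) and (0, du), which are the differentials of the two partial maps. *)
Lemma is_derive_partial (R : realType) (n m p : nat)
    (g : 'rV[R]_n * 'rV[R]_m -> 'rV[R]_p) (x : R -> 'rV[R]_n) (u : R -> 'rV[R]_m)
    (t : R) (dx : 'rV[R]_n) (du : 'rV[R]_m) :
  differentiable g (x t, u t) -> is_derive t 1 x dx -> is_derive t 1 u du ->
  is_derive t 1 (fun s => g (x s, u s))
    (dx *m partial_x g (x t) (u t) + du *m partial_u g (x t) (u t)).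
Proof.
move=> dg [ex <-] [eu <-].
have dfx : differentiable x t by exact/derivable1_diffP.
have dfu : differentiable u t by exact/derivable1_diffP.
have dxu : differentiable (fun s => (x s, u s)) t by exact: differentiable_pair.
have dgxu : differentiable (g \o (fun s => (x s, u s))) t by exact: differentiable_comp.
split; first exact/derivable1_diffP.
rewrite /partial_x /partial_u.
have dxl : differentiable (fun z => (z, u t)) (x t) by exact: differentiable_pair.
have dul : differentiable (fun z => (x t, z)) (u t) by exact: differentiable_pair.
have dgx : differentiable (g \o (fun z => (z, u t))) (x t) by exact: differentiable_comp.
have dgu : differentiable (g \o (fun z => (x t, z))) (u t) by exact: differentiable_comp.
have Ex v : 'd (fun z => g (z, u t)) (x t) v = 'd g (x t, u t) (v, 0).
  rewrite -[fun z => g (z, u t)]/(g \o (fun z => (z, u t))) diff_comp//=.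
  by rewrite diff_pair//= diff_cst diff_val.
have Eu v : 'd (fun z => g (x t, z)) (u t) v = 'd g (x t, u t) (0, v).
  rewrite -[fun z => g (x t, z)]/(g \o (fun z => (x t, z))) diff_comp//=.
  by rewrite diff_pair//= diff_cst diff_val.
have Eg v : 'd (fun s => g (x s, u s)) t v = 'd g (x t, u t) ('d x t v, 'd u t v).
  rewrite -[fun s => g (x s, u s)]/(g \o (fun s => (x s, u s))) diff_comp//=.
  by rewrite diff_pair.
rewrite -!deriveEjacobian// !deriveE// Eg Ex Eu -linearD/=.
by congr ('d g _ _); congr pair; rewrite ?addr0 ?add0r.
Qed.

(** The integrating factor expR t makes each coordinate of expR t *: e t have zero derivative off D,
    so [derive0_finite_exception] applies coordinatewise. *)
Lemma exp_decay (R : realType) (m : nat) (e : R -> 'rV[R]_m) (D : set R) (a : R) :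
  (forall t, a <= t -> {for t, continuous e}) ->
  (forall b, finite_set (D `&` `[a, b])) ->
  (forall t, a < t -> ~ D t -> is_derive t 1 e (- e t)) ->
  forall t, a <= t -> e t = expR (a - t) *: e a.
Proof.
move=> ce finD de b ab; apply/rowP => j; rewrite mxE.
have /finite_seqP[s Ds] := finD b.
pose w (t : R) := expR t * e t ord0 j.
have cw : {in `[a, b], continuous w}.
  move=> t; rewrite in_itv/= => /andP[at_ _].
  apply: cvgM; first exact: continuous_expR.
  apply: (@cvg_comp _ _ _ e (fun v : 'rV[R]_m => v ord0 j)); first exact: ce.
  exact: coord_continuous.
have dw t : t \in `]a, b[ -> t \notin s -> is_derive t 1 w 0.
  rewrite in_itv/= => /andP[at_ tb] ts.
  have NDt : ~ D t.
    move=> Dt; move/negP : ts; apply.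
    have : (D `&` `[a, b]) t by split => //=; rewrite in_itv/= !ltW.
    by rewrite Ds.
  have [det Det] := de t at_ NDt.
  have dej : is_derive t 1 (fun s => e s ord0 j) (- e t ord0 j).
    split; first by move/derivable_mxP : det; exact.
    by have := derive_mx det; rewrite Det => /rowP/(_ j); rewrite !mxE.
  apply: is_derive_eq.
  by rewrite /GRing.scale/= mulrN mulrC addNr.
have := derive0_finite_exception ab cw dw; rewrite /w => wab.
by rewrite expRD mulrAC wab mulrAC -expRD subrr expR0 mul1r.
Qed.

Lemma continuous_at_within0y (R : realType) (V : normedModType R) (z : R -> V) (t : R) :
  {within `[0, +oo[, continuous z} -> 0 < t -> {for t, continuous z}.
Proof.
move=> cz t0; apply: (@within_continuous_continuous _ _ _ 0 (t + 1)).
- by rewrite addr_gt0.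
- by apply: continuous_subspaceW cz => s /=; rewrite !in_itv/= andbT => /andP[].
- by rewrite in_itv/= t0 ltrDl ltr01.
Qed.

Lemma cvg_expRB (R : realType) (a K : R) : expR (a - t) * K @[t --> +oo] --> 0.
Proof.
rewrite -[0](mul0r K) -[in 0 * K](mulr0 (expR a)).
under eq_fun do rewrite expRD.
apply: cvgM; last exact: cvg_cst.
by apply: cvgM; [exact: cvg_cst|exact: cvgr_expR].
Qed.

Theorem mainTheorem2 (R : realType) (n m : nat) (T : R) (hT : 0 < T)
  (f : 'rV[R]_n * 'rV[R]_m -> 'rV[R]_n) (h : 'rV[R]_n -> 'rV[R]_m)
  (g : 'rV[R]_n * 'rV[R]_m -> 'rV[R]_m) (r : R -> 'rV[R]_m)
  (hf : continuously_differentiable f) (hfg : linear_growth f)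
  (hh : continuously_differentiable h)
  (hg : continuously_differentiable g)
  (hrc : {within `[0, +oo[, continuous r}) (hrd : piecewise_differentiable r)
  (x0 : 'rV[R]_n) (x : R -> 'rV[R]_n) (u y yhat : R -> 'rV[R]_m)
  (hcl : closed_loop T f h g r x0 x u y yhat)
  (hns : nonsingular_trajectory g x u) :
  let eta1 := limsup_enorm (prediction_error T yhat y) in
  limsup_enorm (fun t => r t - y t) = eta1.
Proof.
move=> eta1; rewrite {}/eta1.
have [D [finD dr]] := hrd.
have [_ cu xE yE yhatE uE] := hcl.
pose e (t : R) : 'rV[R]_m := r (t + T) - g (x t, u t).
have dx (t : R) : 0 < t -> is_derive t 1 x (f (x t, u t)).
  by move=> t0; apply: has_derivative_is_derive => //; apply/xE/ltW.
have ce (t : R) : 1 <= t -> {for t, continuous e}.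
  move=> t1; have t0 : 0 < t by exact: lt_le_trans t1.
  have ct : {for t, continuous x}.
    by apply/differentiable_continuous/derivable1_diffP; have [] := dx t t0.
  apply: cvgB.
    apply: (@cvg_comp _ _ _ (fun s => s + T) r).
      by apply: cvgD; [exact: cvg_id|exact: cvg_cst].
    by apply: continuous_at_within0y => //; rewrite addr_gt0.
  have cg : {for (x t, u t), continuous g}.
    by apply: differentiable_continuous; exact: hg.1.
  apply: (@cvg_comp _ _ _ (fun s => (x s, u s)) g _ (nbhs (x t, u t))).
    have cut : {for t, continuous u} by exact: continuous_at_within0y.
    exact: cvg_pair ct cut.
  exact: cg.
have de (t : R) : 1 < t -> ~ D (t + T) -> is_derive t 1 e (- e t).
  move=> t1 NDt; have t0 : 0 < t by exact: lt_trans t1.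
  have drT : derivable r (t + T) 1 by apply: dr => //; rewrite addr_gt0.
  have du := has_derivative_is_derive t0 (uE t (ltW t0) drT).
  have dg := is_derive_partial (hg.1 (x t, u t)) (dx t t0) du.
  have drt : is_derive t 1 (fun s => r (s + T)) (derive1 r (t + T)).
    have shiftE : (fun k : R => k^-1 *: (((fun s => r (s + T)) \o shift t) (k *: 1)
        - r (t + T))) = (fun k => k^-1 *: ((r \o shift (t + T)) (k *: 1) - r (t + T))).
      by apply/funext => k /=; rewrite addrA.
    by split; [rewrite /derivable shiftE|rewrite derive1E /derive shiftE].
  apply: is_derive_eq.
  (* Nonsingularity enters here: [invmx] cancels against [partial_u], after which the feedforward
     term cancels the drift through [partial_x]. *)
  rewrite mulmxKV; last exact/hns/ltW.
  rewrite yhatE ?ltW// /e.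
  by rewrite [f _ *m _ + _]addrC subrK opprD addrC subrK.
have fin (b : R) : finite_set ([set t | D (t + T)] `&` `[1, b]).
  apply: (@sub_finite_set _ _ ((fun s => s - T) @` (D `&` `[0, b + T]))); last exact: finite_image.
  move=> t /= [Dt]; rewrite in_itv/= => /andP[t1 tb]; exists (t + T); last by rewrite addrK.
  by split=> //=; rewrite in_itv/= lerD2r tb andbT addr_ge0 ?ltW// (lt_le_trans _ t1).
have eE := exp_decay ce fin de.
have eN (t : R) : 1 <= t -> enorm (e t) = expR (1 - t) * enorm (e 1).
  by move=> t1; rewrite eE// enormZ ger0_norm// expR_ge0.
have predE (t : R) : 0 <= t ->
    r (t + T) - y (t + T) = e t + prediction_error T yhat y t.
  by move=> t0; rewrite /e /prediction_error yhatE// addrA subrK.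
apply/eqP; rewrite eq_le; apply/andP; split.
(* The identity [predE] is used at t - T, so the decay factor expR (1 - (t - T)) becomes expR (1 + T
   - t). *)
- apply: (@le_limf_esup_shift _ (- T) _ _ (fun t => expR (1 + T - t) * enorm (e 1))); last exact: cvg_expRB.
  near=> t.
  have tT : 1 <= t - T by rewrite lerBrDr; near: t; apply: nbhs_pinfty_ge; exact: num_real.
  have := predE (t - T); rewrite subrK => ->; last by rewrite (le_trans _ tT).
  apply: (le_trans (ler_enormD _ _)).
  by rewrite eN// addrC opprB addrA.
(* Conversely, the prediction error is the tracking error at t + T minus e t. *)
- apply: (@le_limf_esup_shift _ T _ _ (fun t => expR (1 - t) * enorm (e 1))); last exact: cvg_expRB.
  near=> t.
  have t1 : 1 <= t by near: t; apply: nbhs_pinfty_ge; exact: num_real.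
  rewrite predE; last by rewrite (le_trans _ t1).
  rewrite -eN// -[leLHS]/(enorm _) -[enorm (e t)]enormN.
  by rewrite -{1}(addrK (e t) (prediction_error _ _ _ _)) [_ + e t]addrC ler_enormD.
Unshelve. all: by end_near. Qed.
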